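(* Let $A\in\mathbb{S}_1$, $D\in\mathbb{S}_2$, $E\in\mathbb{S}_3$ and $L\in\mathbb{R}^{k\times l}$. Suppose that $w=[x^\top,y^\top,z^\top]^\top$ is the unique solution of the double saddle point problem $\mathfrak{B}w=b$. When $\tau=\gamma=\infty$, the structured partial condition number of $w$ with respect to $L$ is $$\mathfrak{K}^{\infty,\mathbb{S}}_{\varphi}(\mathbf{H},b;L)=\left\||\Theta_{\xi_L^\ddagger}|\left|L\mathfrak{B}^{-1}\begin{bmatrix}\mathcal{G}&-I_l\end{bmatrix}\begin{bmatrix}\Phi_{\mathbb{S}} & 0 \\ 0 & I_l\end{bmatrix}\right|\begin{bmatrix}\mathrm{vec}_{\mathbb{S}}(|\Psi|) \\ |\chi|\end{bmatrix}\right\|_\infty.$$ Moreover, suppose $Lw\ne0$ and take $\Psi=\mathbf{H}$, $\chi=b$. If $\xi_L=\|Lw\|_\infty\mathbf{1}_k$, the resulting structured partial mixed condition number is $$\mathfrak{K}^{\infty,\mathbb{S}}_{mix,\varphi}(\mathbf{H},b;L)=\frac{\left\|\left|L\mathfrak{B}^{-1}\begin{bmatrix}\mathcal{G}&-I_l\end{bmatrix}\begin{bmatrix}\Phi_{\mathbb{S}} & 0 \\ 0 & I_l\end{bmatrix}\right|\begin{bmatrix}\mathrm{vec}_{\mathbb{S}}(|\mathbf{H}|) \\ |b|\end{bmatrix}\right\|_\infty}{\|Lw\|_\infty},$$ and if $\xi_L=Lw$, the resulting structured partial componentwise condition number is $$\mathfrak{K}^{\infty,\mathbb{S}}_{com,\varphi}(\mathbf{H},b;L)=\left\|\frac{\left|L\mathfrak{B}^{-1}\begin{bmatrix}\mathcal{G}&-I_l\end{bmatrix}\begin{bmatrix}\Phi_{\mathbb{S}}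 & 0 \\ 0 & I_l\end{bmatrix}\right|\begin{bmatrix}\mathrm{vec}_{\mathbb{S}}(|\mathbf{H}|) \\ |b|\end{bmatrix}}{|Lw|}\right\|_\infty.$$
   Context: Let $A\in\mathbb{R}^{n\times n}$, $B\in\mathbb{R}^{m\times n}$, $C\in\mathbb{R}^{p\times m}$, $D\in\mathbb{R}^{m\times m}$, $E\in\mathbb{R}^{p\times p}$, $l=n+m+p$, $b\in\mathbb{R}^{l}$, and $$\mathfrak{B}=\begin{bmatrix} A & B^\top & 0 \\ B & -D & C^\top \\ 0 & C & E \end{bmatrix},$$ which is assumed nonsingular throughout. The double saddle point problem (DSPP) is $\mathfrak{B}w=b$ with $w=[x^\top,y^\top,z^\top]^\top$, $x\in\mathbb R^n$, $y\in\mathbb R^m$, $z\in\mathbb R^p$. Notation: $\mathrm{vec}$ stacks the columns of a matrix; for a tuple of matrices $\mathrm{vec}(X_1,\dots,X_r)=[\mathrm{vec}(X_1)^\top,\dots,\mathrm{vec}(X_r)^\top]^\top$. $\otimes$ is the Kronecker product, $\odot$ the entrywise product and $|X|$ the entrywise absolute value. $\Theta_v$ is the diagonal matrix with diagonal $v$. For a vector or matrix $v$, $v^\ddagger$ has entries $1/v_i$ if $v_i\ne0$ and $1$ if $v_i=0$; $\odot,\ddagger$ act componentwise on tuples. The entrywise quotient of vectors is $\frac{u}{v}=v^\ddagger\odot u$. $\mathbf{1}_k\in\mathbb R^k$ is the all-ones vector. Write $\mathbf{H}=(A,B,C,D,E)$ and $$\mathcal{G}=\begin{bmatrix} x^\top\otimes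 I_n & I_n\otimes y^\top & 0 & 0 & 0 \\ 0 & x^\top\otimes I_m & I_m\otimes z^\top & -y^\top\otimes I_m & 0 \\ 0 & 0 & y^\top\otimes I_p & 0 & z^\top\otimes I_p \end{bmatrix}.$$ Linear structures: $\mathbb{S}_1\subseteq\mathbb{R}^{n\times n}$, $\mathbb{S}_2\subseteq\mathbb{R}^{m\times m}$, $\mathbb{S}_3\subseteq\mathbb{R}^{p\times p}$ are linear subspaces of structured matrices (such as symmetric or Toeplitz) of dimensions $s,r,q$. For each there is a fixed structure matrix $\Phi_{\mathbb{S}_1}\in\mathbb{R}^{n^2\times s}$, $\Phi_{\mathbb{S}_2}\in\mathbb{R}^{m^2\times r}$, $\Phi_{\mathbb{S}_3}\in\mathbb{R}^{p^2\times q}$ such that every $X\in\mathbb{S}_i$ has a unique generating vector $g$ with $\mathrm{vec}(X)=\Phi_{\mathbb{S}_i}g$. These structure matrices have mutually orthogonal columns and at most one nonzero entry in each row, and are such that whenever $\Psi_X,\Delta X\in\mathbb{S}_i$ have generating vectors $\psi,\delta$ and entries of $\Delta X$ vanish wherever those of $\Psi_X$ vanish, $\mathrm{vec}(\Psi_X^\ddagger\odot\Delta X)=\Phi_{\mathbb{S}_i}(\psi^\ddagger\odot\delta)$. Put $$\Phi_{\mathbb{S}}=\begin{bmatrix}\Phi_{\mathbb{S}_1} & 0 & 0 & 0 \\ 0 & I_{mn+mp} & 0 & 0 \\ 0 & 0 & \Phi_{\mathbb{S}_2} & 0 \\ 0 & 0 & 0 & \Phi_{\mathbb{S}_3}\end{bmatrix}.$$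 For $\Psi=(\Psi_A,\Psi_B,\Psi_C,\Psi_D,\Psi_E)$ with $\Psi_A\in\mathbb{S}_1$, $\Psi_B\in\mathbb{R}^{m\times n}$, $\Psi_C\in\mathbb{R}^{p\times m}$, $\Psi_D\in\mathbb{S}_2$, $\Psi_E\in\mathbb{S}_3$, and generating vectors $\psi_A,\psi_D,\psi_E$ of $\Psi_A,\Psi_D,\Psi_E$, put $\mathrm{vec}_{\mathbb{S}}(\Psi)=[\psi_A^\top,\mathrm{vec}(\Psi_B)^\top,\mathrm{vec}(\Psi_C)^\top,\psi_D^\top,\psi_E^\top]^\top$ and let $\mathrm{vec}_{\mathbb{S}}(|\Psi|)$ be the entrywise absolute value $|\mathrm{vec}_{\mathbb{S}}(\Psi)|$; likewise for $\mathbf{H}$. For $L\in\mathbb{R}^{k\times l}$ ($k\le l$) put $\varphi(\mathbf{H},b)=L\mathfrak{B}^{-1}b$. With parameters $\xi_L\in\mathbb{R}^k$, $\chi\in\mathbb{R}^l$ and $\Psi$ as just described, for $\tau=\gamma=\infty$ the structured partial condition number is $$\mathfrak{K}^{\infty,\mathbb{S}}_{\varphi}(\mathbf{H},b;L)=\lim_{\epsilon\to0}\ \sup_{\substack{0<\|\mathrm{vec}(\Psi^\ddagger\odot\Delta\mathbf{H},\,\chi^\ddagger\odot\Delta b)\|_\infty\le\epsilon\\ \Delta A\in\mathbb{S}_1,\ \Delta D\in\mathbb{S}_2,\ \Delta E\in\mathbb{S}_3}}\frac{\|\xi_L^\ddagger\odot(\varphi(\mathbf{H}+\Delta\mathbf{H},b+\Delta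 b)-\varphi(\mathbf{H},b))\|_\infty}{\|\mathrm{vec}(\Psi^\ddagger\odot\Delta\mathbf{H},\,\chi^\ddagger\odot\Delta b)\|_\infty},$$ where $\Delta\mathbf{H}=(\Delta A,\Delta B,\Delta C,\Delta D,\Delta E)$ and $\Delta b$ also have zero entries wherever the corresponding entry of $\Psi$, respectively $\chi$, is zero. *)

(* Defs.v *)
(* Mathematical Components + MathComp-Analysis. *)
From HB Require Import structures.
From mathcomp Require Export all_boot all_order all_algebra.
From mathcomp Require Export all_classical all_reals all_analysis.
From mathcomp Require Export mxtens.

Set Implicit Arguments.
Unset Strict Implicit.
Unset Printing Implicit Defensive.

Import Order.TTheory GRing.Theory Num.Theory.
Import numFieldNormedType.Exports.

Local Open Scope classical_set_scope.
Local Open Scope ring_scope.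

Section Entrywise.
Context {R : realType}.
Implicit Types m n : nat.

Definition inv1 (t : R) : R := if t == 0 then 1 else t^-1.

Definition mabs m n (X : 'M[R]_(m, n)) := map_mx Num.norm X.
Definition ddag m n (X : 'M[R]_(m, n)) := map_mx inv1 X.
Definition odot m n (X Y : 'M[R]_(m, n)) := map2_mx *%R X Y.
Definition quot n (u v : 'cV[R]_n) : 'cV[R]_n := odot (ddag v) u.
Definition Theta n (v : 'cV[R]_n) : 'M[R]_n := diag_mx v^T.

(* mxvec lists the entries row by row, hence the transpositions. *)
Definition vec m n (X : 'M[R]_(m, n)) : 'cV[R]_(n * m) := (mxvec X^T)^T.

(* [mx_norm] is the largest absolute value of an entry (0 for an empty
   matrix); on column vectors it is the infinity norm. *)
Definition normoo n (v : 'cV[R]_n) : R := mx_norm v.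

Definition supported m n (Psi X : 'M[R]_(m, n)) : Prop :=
  forall i j, Psi i j = 0 -> X i j = 0.

(* The casts identify 1 * n, respectively n * 1, with n. *)
Definition rowtens n m (v : 'cV[R]_n) : 'M[R]_(m, n * m) :=
  castmx (mul1n m, erefl) (tensmx v^T (1%:M : 'M[R]_m)).
Definition tensrow n m (v : 'cV[R]_m) : 'M[R]_(n, n * m) :=
  castmx (muln1 n, erefl) (tensmx (1%:M : 'M[R]_n) v^T).

End Entrywise.

Section DoubleSaddlePoint.
Context {R : realType} {n m p : nat}.

Record blocks := Blocks {
  bA : 'M[R]_n; bB : 'M[R]_(m, n); bC : 'M[R]_(p, m);
  bD : 'M[R]_m; bE : 'M[R]_p }.

Definition blocks_map (f : R -> R) (H : blocks) : blocks :=
  Blocks (map_mx f (bA H)) (map_mx f (bB H)) (map_mx f (bC H))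
         (map_mx f (bD H)) (map_mx f (bE H)).

Definition blocks_map2 (f : R -> R -> R) (H K : blocks) : blocks :=
  Blocks (map2_mx f (bA H) (bA K)) (map2_mx f (bB H) (bB K))
         (map2_mx f (bC H) (bC K)) (map2_mx f (bD H) (bD K))
         (map2_mx f (bE H) (bE K)).

Definition blocks_add := blocks_map2 +%R.
Definition blocks_odot := blocks_map2 *%R.
Definition blocks_ddag := blocks_map inv1.

Definition blocks_supported (Psi H : blocks) : Prop :=
  [/\ supported (bA Psi) (bA H), supported (bB Psi) (bB H),
      supported (bC Psi) (bC H), supported (bD Psi) (bD H)
    & supported (bE Psi) (bE H)].

(* The summands of B and C are grouped to match the identity block of size
   mn + mp in [PhiS]. *)
Definition blocks_vec (H : blocks) :
    'cV[R]_(n * n + (n * m + m * p) + m * m + p * p) :=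
  col_mx (col_mx (col_mx (vec (bA H)) (col_mx (vec (bB H)) (vec (bC H))))
                 (vec (bD H)))
         (vec (bE H)).

Definition saddle_mx (H : blocks) : 'M[R]_(n + m + p) :=
  block_mx (block_mx (bA H) (bB H)^T (bB H) (- bD H))
           (col_mx 0 (bC H)^T)
           (row_mx 0 (bC H))
           (bE H).

Definition Gmx (x : 'cV[R]_n) (y : 'cV[R]_m) (z : 'cV[R]_p) :
    'M[R]_(n + m + p, n * n + (n * m + m * p) + m * m + p * p) :=
  col_mx (col_mx
    (row_mx (row_mx (row_mx (rowtens n x)
      (row_mx (tensrow n y) 0)) 0) 0)
    (row_mx (row_mx (row_mx 0
      (row_mx (rowtens m x) (tensrow m z))) (- rowtens m y)) 0))
    (row_mx (row_mx (row_mx 0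
      (row_mx 0 (rowtens p y))) 0) (rowtens p z)).

Definition phi k (L : 'M[R]_(k, n + m + p)) (H : blocks)
    (b : 'cV[R]_(n + m + p)) : 'cV[R]_k :=
  L *m invmx (saddle_mx H) *m b.

Definition admissible (S1 : {vspace 'M[R]_n}) (S2 : {vspace 'M[R]_m})
    (S3 : {vspace 'M[R]_p}) (Psi : blocks) (chi : 'cV[R]_(n + m + p))
    (dH : blocks) (db : 'cV[R]_(n + m + p)) : Prop :=
  [/\ bA dH \in S1, bD dH \in S2, bE dH \in S3,
      blocks_supported Psi dH & supported chi db].

Definition pert_norm (Psi : blocks) (chi : 'cV[R]_(n + m + p))
    (dH : blocks) (db : 'cV[R]_(n + m + p)) : R :=
  normoo (col_mx (blocks_vec (blocks_odot (blocks_ddag Psi) dH))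
                 (odot (ddag chi) db)).

Section ConditionNumber.
Variables (S1 : {vspace 'M[R]_n}) (S2 : {vspace 'M[R]_m})
          (S3 : {vspace 'M[R]_p}).
Variables (Psi : blocks) (chi : 'cV[R]_(n + m + p)).
Variables (k : nat) (xi : 'cV[R]_k).
Variables (H : blocks) (b : 'cV[R]_(n + m + p)) (L : 'M[R]_(k, n + m + p)).

(* For small eps every admissible perturbation keeps the matrix nonsingular, so
   that the value of [invmx] on singular matrices does not affect the limit. *)
Definition pert_ratios (eps : R) : set (\bar R) :=
  [set t | exists dH db,
     [/\ admissible S1 S2 S3 Psi chi dH db,
         0 < pert_norm Psi chi dH db <= eps
       & t = (normoo (odot (ddag xi)
                (phi L (blocks_add H dH) (b + db) - phi L H b))
              / pert_norm Psi chi dH db)%:E]].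

(* The supremum is taken in [0, +oo]: adjoining 0 only matters when there is no
   nonzero admissible perturbation (Psi and chi both zero). *)
Definition pert_sup (eps : R) : \bar R :=
  ereal_sup ([set 0%E] `|` pert_ratios eps).

(* The limit exists in [\bar R], see [pert_sup_is_cvg]. *)
Definition struct_cond : \bar R := lim (pert_sup eps @[eps --> 0^'+]).

Lemma pert_sup_is_cvg : cvg (pert_sup eps @[eps --> 0^'+]).
Proof.
apply: nondecreasing_at_right_is_cvge; near=> x.
move=> e1 e2 _ _ le12; apply: ereal_sup_le => t [->|]; first by left.
move=> [dH [db [adm /andP[gt0 le1] ->]]]; right; exists dH, db; split=> //.
by rewrite gt0 (le_trans le1).
Unshelve. all: by end_near. Qed.

End ConditionNumber.

End DoubleSaddlePoint.

Arguments blocks : clear implicits.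

Section LinearStructures.
Context {R : realType}.

Record structure_matrix n s (S : {vspace 'M[R]_n}) (Phi : 'M[R]_(n * n, s)) :
    Prop := StructureMatrix {
  structure_dim : \dim S = s;
  structure_gen : forall X, X \in S -> exists! g : 'cV[R]_s, vec X = Phi *m g;
  structure_orth : forall j j', j != j' -> (col j Phi)^T *m col j' Phi = 0;
  structure_row : forall i j j', Phi i j != 0 -> Phi i j' != 0 -> j = j';
  structure_ddag : forall (PsiX dX : 'M[R]_n) (psi delta : 'cV[R]_s),
    PsiX \in S -> dX \in S ->
    vec PsiX = Phi *m psi -> vec dX = Phi *m delta ->
    supported PsiX dX ->
    vec (odot (ddag PsiX) dX) = Phi *m odot (ddag psi) delta }.

(* The generating vector of X; the default 0 is used only if there is none. *)
Definition genvec n s (Phi : 'M[R]_(n * n, s)) (X : 'M[R]_n) : 'cV[R]_s :=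
  xget 0 [set g | vec X = Phi *m g].

Variables (n m p s r q : nat).
Variables (Phi1 : 'M[R]_(n * n, s)) (Phi2 : 'M[R]_(m * m, r))
          (Phi3 : 'M[R]_(p * p, q)).

Definition PhiS : 'M[R]_(n * n + (n * m + m * p) + m * m + p * p,
                         s + (n * m + m * p) + r + q) :=
  block_mx (block_mx (block_mx Phi1 0 0 1%:M) 0 0 Phi2) 0 0 Phi3.

Definition vecS (Psi : blocks R n m p) : 'cV[R]_(s + (n * m + m * p) + r + q) :=
  col_mx (col_mx (col_mx (genvec Phi1 (bA Psi))
                         (col_mx (vec (bB Psi)) (vec (bC Psi))))
                 (genvec Phi2 (bD Psi)))
         (genvec Phi3 (bE Psi)).

(* vec_S(|Psi|) stands for |vec_S(Psi)|; |Psi| itself need not be structured. *)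
Definition vecS_abs (Psi : blocks R n m p) := mabs (vecS Psi).

End LinearStructures.

(* Main.v *)
Require Import Defs.
From mathcomp Require Import ring lra.

Set Implicit Arguments.
Unset Strict Implicit.
Unset Printing Implicit Defensive.

Import Order.TTheory GRing.Theory Num.Theory.
Import numFieldNormedType.Exports.

Local Open Scope ring_scope.

(** Write [S] for the saddle point matrix, [dS] for its perturbation, and [dw]
for the change of the solution [w].  Then [(S + dS) dw = db - dS w], so that to
first order [dw] is [S^-1 (db - dS w)].  Since [dS w] is [Gmx x y z] applied to
the vectorized perturbation ([Gmx_vec]), and the latter is [PhiS] applied to
its generating vector, [L dw] is to first order [- M d], with [d] the vector of
free parameters of the perturbation.  The error is quadratic
([first_order_expansion]): once [S^-1 dS] is a contraction, [dw] is bounded by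
a multiple of the perturbation, and the neglected term is
[L S^-1 dS dw].

It remains to see that the perturbation size, measured on all matrix entries,
can be measured on the free parameters.  This is where the structure matrices
matter.  Applying the compatibility of [ddag] with generating vectors to a
column [a] of a structure matrix, taken both as scale and as perturbation,
turns every nonzero entry of [a] into 1 on one side and leaves it alone on the
other; hence the nonzero entries are 1 ([structure_entry]).  With at most one
nonzero entry in a row and no zero column, applying the structure matrix only
repeats coordinates and inserts zeros ([structure_selection]).  Such a map
preserves the maximum norm and supports, and commutes with entrywise quotients.

So the condition number is the norm of the linear map [M], with rows scaled by
[ddag xi], over the [d] supported by the generating vector [a] of the scales and
with all quotients [d_j / a_j] at most 1 in absolute value.  The best [d] for a
given row has [d_j = +- a_j], which gives the row of [|M| |a|]
([norm_mulmx_supported], [norm_mulmx_attained]).  The quadratic error confines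
the supremum at radius [eps] to a band of width [O(eps)] around this value
([pert_sup_bounds]).  The mixed and componentwise condition numbers are
instances. *)

(** * The maximum norm of matrices *)

Section MaxNorm.
Context {R : realType}.

Lemma normooE n (v : 'cV[R]_n) : normoo v = `|v|.
Proof. by []. Qed.

Lemma ler_entry_norm m n (X : 'M[R]_(m, n)) i j : `|X i j| <= `|X|.
Proof.
rewrite [leRHS]mx_normrE; apply/bigmax_geP; right.
by exists (i, j).
Qed.

Lemma mx_norm_le m n (X : 'M[R]_(m, n)) (c : R) :
  0 <= c -> (forall i j, `|X i j| <= c) -> `|X| <= c.
Proof.
move=> c0 Xc; rewrite [leLHS]mx_normrE; apply/bigmax_leP.
by split=> // -[i j] _ /=.
Qed.

Lemma mx_norm_mulmx m n p (X : 'M[R]_(m, n)) (Y : 'M[R]_(n, p)) :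
  `|X *m Y| <= n%:R * `|X| * `|Y|.
Proof.
apply: mx_norm_le => [|i j]; first by rewrite !mulr_ge0.
rewrite mxE (le_trans (ler_norm_sum _ _ _))//.
have -> : n%:R * `|X| * `|Y| = \sum_(l < n) (`|X| * `|Y|).
  by rewrite sumr_const card_ord -mulrA mulr_natl.
by apply: ler_sum => l _; rewrite normrM ler_pM ?ler_entry_norm.
Qed.

Lemma norm_col_mx m n k (u : 'M[R]_(m, k)) (v : 'M[R]_(n, k)) :
  `|col_mx u v| = Num.max `|u| `|v|.
Proof.
apply/eqP; rewrite eq_le ge_max; apply/andP; split.
  apply: mx_norm_le => [|i j]; first by rewrite le_max normr_ge0.
  rewrite mxE le_max; case: splitP => l _; first by rewrite ler_entry_norm.
  by rewrite ler_entry_norm orbT.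
apply/andP; split; apply: mx_norm_le => // i j.
  by rewrite -(col_mxEu u v) ler_entry_norm.
by rewrite -(col_mxEd u v) ler_entry_norm.
Qed.

Lemma norm_trmx m n (X : 'M[R]_(m, n)) : `|X^T| = `|X|.
Proof.
wlog suff le : m n X / `|X^T| <= `|X|.
  by apply/eqP; rewrite eq_le le -{1}(trmxK X) le.
by apply: mx_norm_le => // i j; rewrite mxE ler_entry_norm.
Qed.

Lemma norm_row_mx m n k (u : 'M[R]_(k, m)) (v : 'M[R]_(k, n)) :
  `|row_mx u v| = Num.max `|u| `|v|.
Proof. by rewrite -norm_trmx tr_row_mx norm_col_mx !norm_trmx. Qed.

End MaxNorm.

(** * Kronecker products acting on vectorized matrices *)

Section Kronecker.
Context {R : realType}.

Lemma index_allpairs_pair (T1 T2 : eqType) (s1 : seq T1) (s2 : seq T2) x y :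
  x \in s1 -> y \in s2 ->
  index (x, y) [seq (x1, x2) | x1 <- s1, x2 <- s2]
  = (index x s1 * size s2 + index y s2)%N.
Proof.
move=> + ys2; elim: s1 => [//|x1 s1 IH] xs /=; rewrite index_cat.
have pinj : injective (pair x1 : T2 -> T1 * T2) by move=> ? ? [].
have [<-|nx] := eqVneq x1 x.
  by rewrite mem_map// ys2 index_map.
rewrite ifF; last by apply/mapP => -[? _ [e _]]; rewrite e eqxx in nx.
move: xs; rewrite inE eq_sym (negPf nx)/= => /IH ->.
by rewrite size_map mulSn addnA.
Qed.

(** Both orders are lexicographic; for [mxvec_index] this is hidden in the
enumeration of a product type, which [index_allpairs_pair] makes explicit. *)
Lemma mxtens_index_mxvec m n (i : 'I_m) (j : 'I_n) :
  mxtens_index (i, j) = mxvec_index i j.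
Proof.
have vE : val (enum_rank (i, j)) = index (i, j) (enum {: 'I_m * 'I_n}).
  by rewrite -{2}(enum_rankK (i, j)) /enum_val index_uniq ?enum_uniq// -cardE.
apply: val_inj; rewrite /= vE enumT unlock /= /prod_enum.
rewrite index_allpairs_pair ?mem_enum//.
by rewrite !index_enum_ord size_enum_ord.
Qed.

Lemma vec_entry m n (X : 'M[R]_(m, n)) i j :
  vec X (mxtens_index (j, i)) 0 = X i j.
Proof. by rewrite mxE mxtens_index_mxvec mxvecE mxE. Qed.

Lemma sum_mxtens_index m n (F : 'I_(m * n) -> R) :
  \sum_l F l = \sum_(i < m) \sum_(j < n) F (mxtens_index (i, j)).
Proof.
rewrite pair_big; apply: reindex.
exists (@mxtens_unindex m n) => l _; last exact: mxtens_unindexK.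
by case: l => i j; exact: mxtens_indexK.
Qed.

Lemma rowtens_vec m n (x : 'cV[R]_n) (X : 'M[R]_(m, n)) :
  rowtens m x *m vec X = X *m x.
Proof.
apply/colP => i; rewrite !mxE sum_mxtens_index; apply: eq_bigr => j _.
rewrite (bigD1 i)//= vec_entry castmxE cast_ord_id.
rewrite (_ : cast_ord _ i = mxtens_index (ord0, i)); last exact: val_inj.
rewrite tensmxE !mxE eqxx mulr1 big1 ?addr0 1?mulrC// => l /negPf li.
rewrite castmxE cast_ord_id.
rewrite (_ : cast_ord _ i = mxtens_index (ord0, i)); last exact: val_inj.
by rewrite tensmxE !mxE eq_sym li mulr0 mul0r.
Qed.

Lemma tensrow_vec m n (y : 'cV[R]_m) (X : 'M[R]_(m, n)) :
  tensrow n y *m vec X = X^T *m y.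
Proof.
apply/colP => j; rewrite !mxE sum_mxtens_index.
have cE : cast_ord (esym (muln1 n)) j = mxtens_index (j, ord0).
  by apply: val_inj; rewrite /= muln1 addn0.
rewrite (bigD1 j)//= [X in _ + X]big1 ?addr0 => [|l /negPf lj].
  apply: eq_bigr => i _; rewrite vec_entry castmxE cast_ord_id cE tensmxE !mxE.
  by rewrite eqxx mul1r mulrC.
rewrite big1// => i _; rewrite castmxE cast_ord_id cE tensmxE !mxE.
by rewrite eq_sym lj !mul0r.
Qed.

End Kronecker.

(** * The saddle point matrix *)

Section SaddlePoint.
Context {R : realType} {n m p : nat}.
Implicit Types H K : blocks R n m p.

(** The product of the saddle point matrix with a vector is linear in the
blocks as well; [Gmx] is the matrix of this second linear map. *)
Lemma Gmx_vec H (x : 'cV[R]_n) (y : 'cV[R]_m) (z : 'cV[R]_p) :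
  Gmx x y z *m blocks_vec H = saddle_mx H *m col_mx (col_mx x y) z.
Proof.
rewrite /Gmx /blocks_vec /saddle_mx block_mxEv.
rewrite !mul_col_mx !mul_row_col !mul0mx.
rewrite block_mxEv !mul_col_mx !mul_row_col !mulNmx !rowtens_vec !tensrow_vec.
rewrite !mul0mx !addr0 !add0r.
rewrite [in RHS]add_col_mx addr0; congr (col_mx (col_mx _ _) _).
by rewrite addrAC.
Qed.

Lemma saddle_mx_add H K :
  saddle_mx (blocks_add H K) = saddle_mx H + saddle_mx K.
Proof.
have mapD a b (X Y : 'M[R]_(a, b)) : map2_mx +%R X Y = X + Y.
  by apply/matrixP => i j; rewrite !mxE.
rewrite /saddle_mx /= !mapD !add_block_mx add_col_mx add_row_mx !addr0.
by rewrite !linearD.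
Qed.

Lemma norm_vec a b (X : 'M[R]_(a, b)) : `|vec X| = `|X|.
Proof.
apply/eqP; rewrite eq_le; apply/andP; split; apply: mx_norm_le => // i j.
  by rewrite ord1; case: (mxtens_indexP i) => ? ?; rewrite vec_entry ler_entry_norm.
by rewrite -vec_entry ler_entry_norm.
Qed.

Lemma norm_saddle_mx H : `|saddle_mx H| <= `|blocks_vec H|.
Proof.
rewrite /blocks_vec /saddle_mx !block_mxEv.
rewrite !(norm_col_mx, norm_row_mx) !norm_vec !norm_trmx normrN !normr0.
by rewrite !ge_max !le_max !lexx !normr_ge0 !orbT.
Qed.

End SaddlePoint.

(** * Matrices that repeat coordinates *)

Section Selection.
Context {R : realType}.

(** Every row is zero or a unit row, and every unit row occurs.  The action on
columns, rather than the shape of the rows, is what the proofs use. *)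
Definition selection_mx N K (T : 'M[R]_(N, K)) : Prop :=
  (forall i, (exists j, forall g : 'cV_K, (T *m g) i 0 = g j 0)
             \/ forall g : 'cV_K, (T *m g) i 0 = 0)
  /\ forall j, exists i, forall g : 'cV_K, (T *m g) i 0 = g j 0.

Lemma selection_scalar K : selection_mx (1%:M : 'M[R]_K).
Proof.
split=> [i|j]; [left; exists i|exists j] => g; by rewrite mul1mx.
Qed.

Lemma selection_block_diag N1 K1 N2 K2 (T1 : 'M[R]_(N1, K1))
    (T2 : 'M[R]_(N2, K2)) :
  selection_mx T1 -> selection_mx T2 -> selection_mx (block_mx T1 0 0 T2).
Proof.
have mulE (g : 'cV[R]_(K1 + K2)) : block_mx T1 0 0 T2 *m g
    = col_mx (T1 *m usubmx g) (T2 *m dsubmx g).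
  by rewrite -{1}(vsubmxK g) mul_block_col !mul0mx addr0 add0r.
move=> [row1 col1] [row2 col2]; split=> i.
  case: (split_ordP i) => i' ->.
    have [[j jP]|zP] := row1 i'; [left; exists (lshift K2 j)|right] => g.
      by rewrite mulE col_mxEu jP mxE.
    by rewrite mulE col_mxEu zP.
  have [[j jP]|zP] := row2 i'; [left; exists (rshift K1 j)|right] => g.
    by rewrite mulE col_mxEd jP mxE.
  by rewrite mulE col_mxEd zP.
case: (split_ordP i) => j ->.
  by have [l lP] := col1 j; exists (lshift N2 l) => g; rewrite mulE col_mxEu lP mxE.
by have [l lP] := col2 j; exists (rshift N1 l) => g; rewrite mulE col_mxEd lP mxE.
Qed.

Section SelectionTheory.
Variables (N K : nat) (T : 'M[R]_(N, K)).
Hypothesis selT : selection_mx T.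

(** The entries of the image are entries of [g], all of which occur, and
zeros. *)
Lemma selection_norm (g : 'cV_K) : `|T *m g| = `|g|.
Proof.
apply/eqP; rewrite eq_le; apply/andP; split; apply: mx_norm_le => // i o.
  rewrite ord1; have [[j ->]|->] := selT.1 i; first exact: ler_entry_norm.
  by rewrite normr0.
by rewrite ord1; have [l <-] := selT.2 i; exact: ler_entry_norm.
Qed.

Lemma selection_supported (a d : 'cV_K) :
  supported (T *m a) (T *m d) <-> supported a d.
Proof.
split=> sup i o; rewrite ord1.
  by have [l lP] := selT.2 i; rewrite -!lP; exact: sup.
by have [[j jP]|zP] := selT.1 i; rewrite ?jP ?zP//; exact: sup.
Qed.

(** A zero row is harmless, since it makes the numerator vanish. *)
Lemma selection_quot (a d : 'cV_K) :
  odot (ddag (T *m a)) (T *m d) = T *m odot (ddag a) d.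
Proof.
apply/colP => i; rewrite [LHS]mxE mxE.
by have [[j jP]|zP] := selT.1 i; rewrite ?jP ?zP ?mulr0// !mxE.
Qed.

End SelectionTheory.

End Selection.

(** * Vectorization *)

Section Vectorization.
Context {R : realType} {m n : nat}.
Implicit Types X Y : 'M[R]_(m, n).

Definition unvec (v : 'cV[R]_(n * m)) : 'M[R]_(m, n) := (vec_mx v^T)^T.

Lemma unvecK : cancel unvec (@vec R m n).
Proof. by move=> v; rewrite /vec /unvec trmxK vec_mxK trmxK. Qed.

Lemma vecK : cancel (@vec R m n) unvec.
Proof. by move=> X; rewrite /vec /unvec trmxK mxvecK trmxK. Qed.

Lemma vec_quot X Y : vec (odot (ddag X) Y) = odot (ddag (vec X)) (vec Y).
Proof.
apply/colP => l; case: (mxtens_indexP l) => j i.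
by rewrite vec_entry [RHS]mxE [in RHS]mxE !vec_entry !mxE.
Qed.

Lemma vec_supported X Y : supported (vec X) (vec Y) <-> supported X Y.
Proof.
split=> sup i j; first by rewrite -(vec_entry X) -(vec_entry Y); exact: sup.
by rewrite ord1; case: (mxtens_indexP i) => j' i'; rewrite !vec_entry; exact: sup.
Qed.

End Vectorization.

(** * Structure matrices *)

Section StructureMatrix.
Context {R : realType} (n s : nat) (S : {vspace 'M[R]_n}).
Variable Phi : 'M[R]_(n * n, s).
Hypothesis hPhi : structure_matrix S Phi.

(** The zero matrix has only one generating vector, so the kernel is
trivial. *)
Lemma structure_inj (g h : 'cV_s) : Phi *m g = Phi *m h -> g = h.
Proof.
move=> gh; have [g0 [_ g0P]] := structure_gen hPhi (mem0v S).
have vec0 : vec (0 : 'M[R]_n) = 0 by rewrite /vec !linear0.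
have uniq0 (f : 'cV_s) : Phi *m f = 0 -> f = g0.
  by move=> f0; rewrite (g0P f) ?vec0 ?f0.
apply/eqP; rewrite -subr_eq0; apply/eqP.
by rewrite (uniq0 (g - h)) ?mulmxBr ?gh ?subrr// -(uniq0 0) ?mulmx0.
Qed.

(** Every member of [S] is generated, so [S] lies in the image of the
generation map, which by injectivity has the dimension of [S]. *)
Lemma structure_onto (g : 'cV_s) : unvec (Phi *m g) \in S.
Proof.
pose f := linfun (trmx \o @vec_mx R n n \o trmx \o mulmx Phi
                    : 'cV[R]_s -> 'M[R]_n).
have fE h : f h = unvec (Phi *m h) by rewrite lfunE.
have kerf : lker f = 0%VS.
  apply/eqP; rewrite -subv0; apply/subvP => h; rewrite memv_ker memv0 fE.
  move=> /eqP/(congr1 (@vec R n n)); rewrite unvecK /vec !linear0 => h0.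
  by apply/eqP/structure_inj; rewrite h0 mulmx0.
have Sf : (S <= limg f)%VS.
  apply/subvP => X XS; have [h [hX _]] := structure_gen hPhi XS.
  by rewrite -(vecK X) hX -fE memv_img// memvf.
have dimf : \dim (limg f) = s.
  have := limg_ker_dim f {:'cV[R]_s}%VS.
  by rewrite kerf capv0 dimv0 add0n => ->; rewrite dimvf dim_matrix; exact: muln1.
have /eqP -> : S == limg f by rewrite eqEdim Sf dimf (structure_dim hPhi) leqnn.
by rewrite -fE memv_img// memvf.
Qed.

(** With the unit vector [g] of index [j] as generating vector, column [j]
serves both as scale and as perturbation: its entrywise quotient by itself has
ones at its nonzero entries, yet it is generated by the quotient of [g] by
itself, that is by [g]. *)
Lemma structure_entry i j : Phi i j != 0 -> Phi i j = 1.
Proof.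
move=> Pij; pose g : 'cV[R]_s := delta_mx j 0.
have Pg l : (Phi *m g) l 0 = Phi l j by rewrite -colE mxE.
have := structure_ddag hPhi (structure_onto g) (structure_onto g)
  (unvecK _) (unvecK _) (fun _ _ => id).
rewrite vec_quot unvecK => /colP/(_ i); rewrite [LHS]mxE mxE Pg.
rewrite /inv1 (negPf Pij) mulVf// => ->.
suff -> : odot (ddag g) g = g by rewrite Pg.
apply/colP => l; rewrite !mxE /inv1 eqxx andbT.
by case: (l == j); rewrite ?oner_eq0 ?invr1 ?mulr1 ?mulr0.
Qed.

(** A zero column would contradict injectivity; the remaining conditions are
[structure_entry] and [structure_row]. *)
Lemma structure_selection : selection_mx Phi.
Proof.
have rowE i j : Phi i j != 0 -> forall g : 'cV_s, (Phi *m g) i 0 = g j 0.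
  move=> Pij g; rewrite mxE (bigD1 j)//= structure_entry// mul1r.
  rewrite big1 ?addr0// => l lj; have [->|Pil] := eqVneq (Phi i l) 0.
    by rewrite mul0r.
  by rewrite (structure_row hPhi Pil Pij) eqxx in lj.
split=> [i|j].
  have [j Pij|Pi0] := pickP (fun j => Phi i j != 0).
    by left; exists j; exact: rowE.
  right=> g; rewrite mxE big1// => l _.
  by move/negbFE: (Pi0 l) => /eqP ->; rewrite mul0r.
have [i Pij|P0j] := pickP (fun i => Phi i j != 0).
  by exists i; exact: rowE.
have : delta_mx j 0 = 0 :> 'cV[R]_s.
  apply: structure_inj; rewrite mulmx0 -colE; apply/colP => i.
  by rewrite !mxE; apply/eqP/negbFE/P0j.
by move/colP/(_ j)/eqP; rewrite !mxE !eqxx oner_eq0.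
Qed.

Lemma genvecP X : X \in S -> vec X = Phi *m genvec Phi X.
Proof.
move=> XS; have [g [gX _]] := structure_gen hPhi XS.
exact: (xgetPex 0 (ex_intro [set h | vec X = Phi *m h]%classic g gX)).
Qed.

Lemma genvec_unvec g : genvec Phi (unvec (Phi *m g)) = g.
Proof.
by apply: structure_inj; rewrite -genvecP ?unvecK//; exact: structure_onto.
Qed.

End StructureMatrix.

(** * Generating vectors of structured perturbations *)

Section StructuredBlocks.
Context {R : realType} (n m p s r q : nat).
Variables (S1 : {vspace 'M[R]_n}) (S2 : {vspace 'M[R]_m})
          (S3 : {vspace 'M[R]_p}).
Variables (Phi1 : 'M[R]_(n * n, s)) (Phi2 : 'M[R]_(m * m, r))
          (Phi3 : 'M[R]_(p * p, q)).
Hypotheses (hPhi1 : structure_matrix S1 Phi1)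
           (hPhi2 : structure_matrix S2 Phi2)
           (hPhi3 : structure_matrix S3 Phi3).
Implicit Type H : blocks R n m p.

Definition structured H := [/\ bA H \in S1, bD H \in S2 & bE H \in S3].

Let T := block_mx (PhiS Phi1 Phi2 Phi3) 0 0 (1%:M : 'M[R]_(n + m + p)).

Lemma PhiS_block_selection : selection_mx T.
Proof.
apply: selection_block_diag (selection_scalar _).
apply: selection_block_diag (structure_selection hPhi3).
apply: selection_block_diag (structure_selection hPhi2).
exact: selection_block_diag (structure_selection hPhi1) (selection_scalar _).
Qed.

(** [data_vec] lists all entries of the data, [gen_vec] its free parameters;
the right-hand side carries no structure and appears in both. *)
Definition data_vec H (b : 'cV[R]_(n + m + p)) :=
  col_mx (blocks_vec H) b.

Definition gen_vec H (b : 'cV[R]_(n + m + p)) :=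
  col_mx (vecS Phi1 Phi2 Phi3 H) b.

Lemma data_vec_gen H b : structured H -> data_vec H b = T *m gen_vec H b.
Proof.
move=> [HA HD HE]; rewrite /T /PhiS /gen_vec /vecS /data_vec /blocks_vec.
rewrite !mul_block_col !mul0mx !addr0 !add0r !mul1mx.
by rewrite -(genvecP hPhi1)// -(genvecP hPhi2)// -(genvecP hPhi3).
Qed.

Lemma gen_vec_onto g :
  exists H b, structured H /\ gen_vec H b = g.
Proof.
pose g1 := usubmx g.
pose H : blocks R n m p := Blocks (unvec (Phi1 *m usubmx (usubmx (usubmx g1))))
  (unvec (usubmx (dsubmx (usubmx (usubmx g1)))))
  (unvec (dsubmx (dsubmx (usubmx (usubmx g1)))))
  (unvec (Phi2 *m dsubmx (usubmx g1))) (unvec (Phi3 *m dsubmx g1)).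
exists H, (dsubmx g); split.
  split; [exact: structure_onto hPhi1 _|exact: structure_onto hPhi2 _|].
  exact: structure_onto hPhi3 _.
rewrite /gen_vec /vecS/= (genvec_unvec hPhi1) (genvec_unvec hPhi2).
by rewrite (genvec_unvec hPhi3) !unvecK !vsubmxK.
Qed.

Lemma supported_col_mx a1 a2 (u v : 'cV[R]_a1) (u' v' : 'cV[R]_a2) :
  supported (col_mx u u') (col_mx v v') <-> supported u v /\ supported u' v'.
Proof.
split=> [sup|[sup sup'] i j].
  split=> i j; first by have := sup (lshift a2 i) j; rewrite !col_mxEu.
  by have := sup (rshift a1 i) j; rewrite !col_mxEd.
case: (split_ordP i) => i' ->; rewrite ?col_mxEu ?col_mxEd; first exact: sup.
exact: sup'.
Qed.

Lemma odot_ddag_col_mx a1 a2 (u v : 'cV[R]_a1) (u' v' : 'cV[R]_a2) :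
  odot (ddag (col_mx u u')) (col_mx v v')
  = col_mx (odot (ddag u) v) (odot (ddag u') v').
Proof.
apply/colP => i; rewrite [LHS]mxE [in LHS]mxE.
by case: (split_ordP i) => i' ->; rewrite ?col_mxEu ?col_mxEd !mxE.
Qed.

Lemma data_vec_supported Psi chi H b :
  supported (data_vec Psi chi) (data_vec H b)
  <-> blocks_supported Psi H /\ supported chi b.
Proof.
rewrite /data_vec /blocks_vec !supported_col_mx !vec_supported.
split; first by move=> [[[[? [? ?]] ?] ?] ?].
by move=> [[? ? ? ? ?] ?].
Qed.

Lemma admissibleP Psi chi H b : structured Psi ->
  admissible S1 S2 S3 Psi chi H b
  <-> structured H /\ supported (gen_vec Psi chi) (gen_vec H b).
Proof.
move=> sPsi; split=> [[HA HD HE sup supb]|[sH]].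
  split=> //; apply/(selection_supported PhiS_block_selection).
  by rewrite -!data_vec_gen//; apply/data_vec_supported.
move/(selection_supported PhiS_block_selection); rewrite -!data_vec_gen//.
by move/data_vec_supported => [? ?]; case: sH.
Qed.

(** The perturbation size can be read off the free parameters, as the
structure map commutes with quotients and preserves the norm. *)
Lemma pert_normE Psi chi H b : structured Psi -> structured H ->
  pert_norm Psi chi H b = `|odot (ddag (gen_vec Psi chi)) (gen_vec H b)|.
Proof.
move=> sPsi sH; rewrite -(selection_norm PhiS_block_selection).
rewrite -(selection_quot PhiS_block_selection) -!data_vec_gen//.
rewrite /pert_norm /data_vec odot_ddag_col_mx normooE /blocks_vec.
by rewrite !odot_ddag_col_mx/= -!vec_quot.
Qed.

Lemma norm_gen_vec H b : structured H ->
  `|gen_vec H b| = `|data_vec H b|.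
Proof. by move=> sH; rewrite data_vec_gen// (selection_norm PhiS_block_selection). Qed.

End StructuredBlocks.

(** * Weighted operator norm *)

Section DualNorm.
Context {R : realType} {k K : nat}.
Variables (M : 'M[R]_(k, K)) (a : 'cV[R]_K).

Lemma supported_odotK (d : 'cV[R]_K) :
  supported a d -> odot a (odot (ddag a) d) = d.
Proof.
move=> sup; apply/colP => j; rewrite !mxE /inv1.
have [a0|a0] := eqVneq (a j 0) 0; first by rewrite (sup j 0 a0) !mulr0.
by rewrite mulVKf.
Qed.

(** Row by row this is the triangle inequality, after writing [d_j] as [a_j]
times the quotient of [d_j] by [a_j]. *)
Lemma norm_mulmx_supported (d : 'cV[R]_K) : supported a d ->
  `|M *m d| <= `|mabs M *m mabs a| * `|odot (ddag a) d|.
Proof.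
move=> sup; apply: mx_norm_le => [|i o]; first exact: mulr_ge0.
rewrite ord1 -{1}(supported_odotK sup) mxE (le_trans (ler_norm_sum _ _ _))//.
apply: (@le_trans _ _ ((mabs M *m mabs a) i 0 * `|odot (ddag a) d|)); last first.
  by rewrite ler_wpM2r// (le_trans (ler_norm _))// ler_entry_norm.
rewrite mxE mulr_suml; apply: ler_sum => j _.
rewrite [odot a _ _ _]mxE !normrM mulrA ![mabs _ _ _]mxE.
by rewrite ler_wpM2l ?mulr_ge0// ler_entry_norm.
Qed.

(** Choose the row [i] of [|M| |a|] with the largest entry, and give each
[a_j] the sign that makes all terms of row [i] of [M d] nonnegative. *)
Lemma norm_mulmx_attained : exists d : 'cV[R]_K,
  [/\ supported a d, `|odot (ddag a) d| <= 1
    & `|mabs M *m mabs a| <= `|M *m d|].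
Proof.
have [K0|K0] := eqVneq `|mabs M *m mabs a| 0.
  exists 0; rewrite K0; split=> //; first by move=> *; rewrite mxE.
  by rewrite (_ : odot _ _ = 0) ?normr0//; apply/colP => j; rewrite !mxE mulr0.
have [[i o] Ki] := mx_norm_neq0 K0; rewrite /= ord1 in Ki.
pose d : 'cV[R]_K := \col_j (Num.sg (M i j * a j 0) * a j 0).
exists d; split=> [j l||].
- by rewrite ord1 mxE => ->; rewrite mulr0.
- apply: mx_norm_le => // j l; rewrite ord1 !mxE /inv1.
  have [->|aj] := eqVneq (a j 0) 0; first by rewrite !mulr0 normr0.
  rewrite mulrCA mulVf// mulr1.
  by case: sgrP => _; rewrite ?normrN ?normr1 ?normr0.
rewrite [leLHS]Ki; apply: le_trans (ler_entry_norm _ i 0).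
rewrite !mxE (eq_bigr (fun j => `|M i j * a j 0|)); last first.
  by move=> j _; rewrite !mxE normrM.
rewrite (_ : \sum_j M i j * d j 0 = \sum_j `|M i j * a j 0|)//.
by apply: eq_bigr => j _; rewrite mxE mulrCA -normrEsg.
Qed.

End DualNorm.

(** * First-order perturbation of a linear system *)

Section Perturbation.
Context {R : realType} {N : nat}.
Implicit Types S dS : 'M[R]_N.

Lemma norm_contraction (X : 'M[R]_N) (u v : 'cV[R]_N) :
  N%:R * `|X| <= 2^-1 -> u + X *m u = v -> `|u| <= 2 * `|v|.
Proof.
move=> X2 uv; have Xu : `|X *m u| <= 2^-1 * `|u|.
  by rewrite (le_trans (mx_norm_mulmx _ _))// ler_wpM2r.
have : `|u| <= `|v| + `|X *m u| by rewrite -uv -{1}(addrK (X *m u) u) ler_normB.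
lra.
Qed.

(** A vector killed by [S + dS] is a fixed point of the contraction
[- S^-1 dS], hence zero. *)
Lemma unitmx_perturbed S dS : S \in unitmx ->
  N%:R * `|invmx S *m dS| <= 2^-1 -> S + dS \in unitmx.
Proof.
move=> uS X2; rewrite -unitmx_tr -row_free_unit -kermx_eq0.
apply/eqP/row_matrixP => i; rewrite row0.
have /sub_kermxP := row_sub i (kermx (S + dS)^T).
move/(congr1 trmx); rewrite trmx_mul trmxK trmx0; set u := (row _ _)^T => Su.
suff : u = 0 by move/(congr1 trmx); rewrite trmxK trmx0.
apply/normr0_eq0/eqP; rewrite eq_le normr_ge0 andbT.
have := @norm_contraction (invmx S *m dS) u 0 X2; rewrite normr0 mulr0; apply.
by rewrite -{1}(mul1mx u) -mulmxDl -{1}(mulVmx uS) -mulmxDr -mulmxA Su mulmx0.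
Qed.

(** The increment [u] of the solution satisfies [u + X u = S^-1 r] for
[X = S^-1 dS] and [r = db - dS w].  The error of the first-order term is
[- L X u], where [X] is [O(nu)] and, [X] being a contraction, [u] is [O(nu)]
too. *)
Lemma first_order_expansion k (L : 'M[R]_(k, N)) S (w : 'cV[R]_N) (a : R) :
  S \in unitmx -> 0 <= a -> exists c e, [/\ 0 <= c, 0 < e &
    forall dS db nu, 0 <= nu <= e -> `|dS| <= a * nu -> `|db| <= a * nu ->
      `|L *m invmx (S + dS) *m (S *m w + db) - L *m w
        - L *m invmx S *m (db - dS *m w)| <= c * nu ^+ 2].
Proof.
move=> uS a0; pose al := `|invmx S|.
pose ka := N%:R * (N%:R * al * a); pose ro := a * (1 + N%:R * `|w|).
have al0 : 0 <= al by exact: normr_ge0.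
have ka0 : 0 <= ka by rewrite /ka !mulr_ge0.
have ro0 : 0 <= ro by rewrite /ro mulr_ge0// addr_ge0// mulr_ge0.
(* [ka * nu] bounds [N |X|] and [ro * nu] bounds [|r|]; the radius makes
   [ka * nu] at most 1/2. *)
exists (N%:R * `|L| * (ka * (2 * (N%:R * al * ro)))), (2 * ka + 1)^-1.
have kk : 0 < 2 * ka + 1 by lra.
split; [by rewrite !mulr_ge0|by rewrite invr_gt0|].
move=> dS db nu /andP[nu0 nue] hdS hdb.
pose X := invmx S *m dS; pose r := db - dS *m w.
have Xle : N%:R * `|X| <= ka * nu.
  rewrite /ka -mulrA ler_wpM2l// (le_trans (mx_norm_mulmx _ _))// -mulrA.
  by rewrite -[leRHS]mulrA -[leRHS]mulrA ler_wpM2l// ler_wpM2l.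
have X2 : N%:R * `|X| <= 2^-1.
  apply: (le_trans Xle); have : nu * (2 * ka + 1) <= 1.
    by rewrite -ler_pdivlMr// div1r.
  lra.
have rle : `|r| <= ro * nu.
  rewrite (le_trans (ler_normB _ _))// /ro mulrDr mulrDl mulr1 lerD//.
  rewrite (le_trans (mx_norm_mulmx _ _))//.
  rewrite (_ : a * _ * nu = N%:R * (a * nu) * `|w|); last by ring.
  by rewrite ler_wpM2r// ler_wpM2l.
have uSd := unitmx_perturbed uS X2.
pose u := invmx (S + dS) *m (S *m w + db) - w.
have uE : u + X *m u = invmx S *m r.
  rewrite -{1}(mul1mx u) -mulmxDl -{1}(mulVmx uS) /X -mulmxDr -mulmxA; congr (_ *m _).
  by rewrite /u mulmxBr mulKVmx// mulmxDl /r opprD addrACA subrr add0r.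
have ule : `|u| <= 2 * (N%:R * al * ro) * nu.
  rewrite (le_trans (norm_contraction X2 uE))// -mulrA ler_wpM2l//.
  by rewrite (le_trans (mx_norm_mulmx _ _))// -[leRHS]mulrA ler_wpM2l.
rewrite (_ : _ - _ - _ = - (L *m (X *m u))); last first.
  have -> : L *m invmx (S + dS) *m (S *m w + db) - L *m w = L *m u.
    by rewrite /u mulmxBr mulmxA.
  by rewrite -/r -(mulmxA L) -uE (mulmxDr L u) opprD addrA subrr add0r.
rewrite normrN (le_trans (mx_norm_mulmx _ _))// -[leRHS]mulrA ler_wpM2l ?mulr_ge0//.
rewrite (le_trans (mx_norm_mulmx _ _))//.
rewrite (_ : _ * nu ^+ 2 = (ka * nu) * (2 * (N%:R * al * ro) * nu)); last by ring.
by rewrite ler_pM// mulr_ge0.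
Qed.

End Perturbation.

(** * The structured condition number *)

Section ConditionNumber.
Context {R : realType} (n m p s r q k : nat).
Variables (S1 : {vspace 'M[R]_n}) (S2 : {vspace 'M[R]_m})
          (S3 : {vspace 'M[R]_p}).
Variables (Phi1 : 'M[R]_(n * n, s)) (Phi2 : 'M[R]_(m * m, r))
          (Phi3 : 'M[R]_(p * p, q)).
Hypotheses (hPhi1 : structure_matrix S1 Phi1)
           (hPhi2 : structure_matrix S2 Phi2)
           (hPhi3 : structure_matrix S3 Phi3).
Variables (H : blocks R n m p) (b : 'cV[R]_(n + m + p)).
Variables (x : 'cV[R]_n) (y : 'cV[R]_m) (z : 'cV[R]_p).
Variable L : 'M[R]_(k, n + m + p).

Let w := col_mx (col_mx x y) z.
Let T := block_mx (PhiS Phi1 Phi2 Phi3) 0 0 (1%:M : 'M[R]_(n + m + p)).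
Let M := L *m invmx (saddle_mx H) *m row_mx (Gmx x y z) (- 1%:M) *m T.

Hypothesis unitH : saddle_mx H \in unitmx.
Hypothesis solw : saddle_mx H *m w = b.

Variables (Psi : blocks R n m p) (chi : 'cV[R]_(n + m + p)).
Variable xi : 'cV[R]_k.
Hypothesis sPsi : structured S1 S2 S3 Psi.

Notation gvec := (gen_vec Phi1 Phi2 Phi3).
Let M' := Theta (ddag xi) *m M.
Let a := gvec Psi chi.
Let K := `|mabs M' *m mabs a|.

Lemma odot_Theta (u v : 'cV[R]_k) : odot u v = Theta u *m v.
Proof. by apply/colP => i; rewrite mul_diag_mx !mxE. Qed.

(** [first_order_expansion] for structured data; the sizes of the saddle
matrix and right-hand side perturbations are bounded by that of the generating
vector, hence by [|a|] times the perturbation size. *)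
Lemma phi_expansion : exists c e, [/\ 0 <= c, 0 < e &
  forall dH db, admissible S1 S2 S3 Psi chi dH db ->
    pert_norm Psi chi dH db <= e ->
  `|odot (ddag xi) (phi L (blocks_add H dH) (b + db) - phi L H b)
    + M' *m gvec dH db| <= c * pert_norm Psi chi dH db ^+ 2].
Proof.
have [c [e [c0 e0 expn]]] :=
  first_order_expansion (Theta (ddag xi) *m L) w unitH (normr_ge0 a).
exists c, e; split=> // dH db adm.
have [sdH sup] := (admissibleP hPhi1 hPhi2 hPhi3 _ _ _ sPsi).1 adm.
rewrite (pert_normE hPhi1 hPhi2 hPhi3)//.
set d := gvec dH db in sup *; set nu := `|odot _ _| => nue.
have d_le : `|d| <= `|a| * nu.
  rewrite -{1}(supported_odotK sup); apply: mx_norm_le => [|i j].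
    by rewrite mulr_ge0 ?normr_ge0.
  by rewrite mxE normrM ler_pM ?ler_entry_norm.
have data_le : Num.max `|blocks_vec dH| `|db| <= `|a| * nu.
  by rewrite -norm_col_mx -[col_mx _ _]/(data_vec dH db)
    -(norm_gen_vec hPhi1 hPhi2 hPhi3).
move: data_le; rewrite ge_max => /andP[dH_le db_le].
have dS_le := le_trans (norm_saddle_mx dH) dH_le.
have := expn _ _ nu _ dS_le db_le; rewrite normr_ge0 nue => /(_ isT).
congr (`|_| <= _); rewrite odot_Theta /phi saddle_mx_add solw.
rewrite (mulmxBr (Theta _)); congr (_ - _ + _).
- by rewrite !mulmxA.
- by rewrite -solw -!mulmxA mulKmx.
have res : row_mx (Gmx x y z) (- 1%:M) *m data_vec dH db
    = - (db - saddle_mx dH *m w).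
  by rewrite mul_row_col Gmx_vec mulNmx mul1mx opprB.
rewrite /M' /M -!mulmxA -(data_vec_gen hPhi1 hPhi2 hPhi3)// res.
by rewrite !mulmxN.
Qed.

(** Dividing the quadratic error by the perturbation size leaves [O(eps)].
The lower bound comes from scaling the extremal direction of
[norm_mulmx_attained] to size exactly [eps]. *)
Lemma pert_sup_bounds : exists c e, [/\ 0 <= c, 0 < e &
  forall eps, 0 < eps <= e ->
   ((K - c * eps)%:E <= pert_sup S1 S2 S3 Psi chi xi H b L eps
      <= (K + c * eps)%:E)%E].
Proof.
have [c [e [c0 e0 expn]]] := phi_expansion.
exists c, e; split=> // eps /andP[eps0 epse]; apply/andP; split; last first.
  apply: ge_ereal_sup => t [->|].
    by rewrite lee_fin addr_ge0 ?mulr_ge0 ?normr_ge0// ltW.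
  move=> [dH [db [adm /andP[nu0 nueps] ->]]]; rewrite lee_fin.
  have := expn dH db adm (le_trans nueps epse).
  have [sdH sup] := (admissibleP hPhi1 hPhi2 hPhi3 _ _ _ sPsi).1 adm.
  have := norm_mulmx_supported M' sup.
  rewrite -(pert_normE hPhi1 hPhi2 hPhi3)// normooE.
  set nu := pert_norm _ _ _ _ in nu0 nueps *.
  set u := odot (ddag xi) _; set v := M' *m _ => vK uv.
  rewrite ler_pdivrMr//.
  have : `|u| <= `|u + v| + `|v| by rewrite -{1}(addrK v u) ler_normB.
  have : c * nu ^+ 2 <= c * eps * nu by rewrite expr2 mulrA ler_wpM2r ?ler_wpM2l// ltW.
  rewrite -/K in vK *; lra.
have [K0|K0] := eqVneq K 0.
  (* There may be no nonzero perturbation; the adjoined 0 gives the bound. *)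
  rewrite K0 add0r; apply: (@le_trans _ _ 0%E).
    by rewrite lee_fin oppr_le0 mulr_ge0// ltW.
  by apply: ereal_sup_ubound; left.
have [d [sup d1 Kd]] := norm_mulmx_attained M' a.
have Kgt0 : 0 < K by rewrite lt_neqAle eq_sym K0 normr_ge0.
(* [d] has size exactly 1: a smaller size would contradict
   [norm_mulmx_supported]. *)
have {}d1 : `|odot (ddag a) d| = 1.
  apply/eqP; rewrite eq_le d1/= -(ler_pM2l Kgt0) mulr1.
  exact: le_trans Kd (norm_mulmx_supported M' sup).
have [dH [db [sdH gE]]] := gen_vec_onto hPhi1 hPhi2 hPhi3 (eps *: d).
have nuE : pert_norm Psi chi dH db = eps.
  rewrite (pert_normE hPhi1 hPhi2 hPhi3)// gE.
  rewrite (_ : odot _ _ = eps *: odot (ddag a) d).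
    by rewrite normrZ d1 mulr1 gtr0_norm.
  by apply/colP => j; rewrite !mxE mulrCA.
have adm : admissible S1 S2 S3 Psi chi dH db.
  apply/(admissibleP hPhi1 hPhi2 hPhi3 _ _ _ sPsi); split=> //.
  by rewrite gE => i j ai0; rewrite mxE (sup i j ai0) mulr0.
apply: (@le_trans _ _ ((normoo (odot (ddag xi)
    (phi L (blocks_add H dH) (b + db) - phi L H b)) / eps)%:E)); last first.
  apply: ereal_sup_ubound; right; exists dH, db; split=> //.
    by rewrite nuE eps0 lexx.
  by rewrite nuE.
rewrite lee_fin ler_pdivlMr// normooE.
have := expn dH db adm; rewrite nuE => /(_ epse).
rewrite gE -scalemxAr; set u := odot (ddag xi) _; set v := _ *: _ => uv.
have : `|v| <= `|u + v| + `|u| by rewrite -{1}(addKr u v) addrC ler_normB.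
have : eps * K <= `|v| by rewrite normrZ gtr0_norm// ler_wpM2l// ltW.
rewrite expr2 in uv; lra.
Qed.

Lemma struct_condE : struct_cond S1 S2 S3 Psi chi xi H b L = K%:E.
Proof.
have [c [e [c0 e0 bnd]]] := pert_sup_bounds.
apply: cvg_lim => //.
have lin (c' : R) : ((K + c' * eps)%:E @[eps --> 0^'+] --> K%:E)%classic.
  apply: cvg_EFin; first exact: nearW.
  rewrite -[X in (_ --> X)%classic]addr0 -[X in (_ --> _ + X)%classic](mulr0 c').
  apply: cvgD; first exact: cvg_cst.
  by apply: cvgZr; apply: cvg_within.
apply: (squeeze_cvge _ (lin (- c)) (lin c)).
near=> eps; rewrite mulNr; apply: bnd.
by apply/andP; split; near: eps; [exact: nbhs_right_gt|exact: nbhs_right_le].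
Unshelve. all: by end_near. Qed.

End ConditionNumber.

(** * Row scalings *)

Section EntrywiseAlgebra.
Context {R : realType}.

Lemma mabs_Theta_mulmx k K (v : 'cV[R]_k) (X : 'M[R]_(k, K)) :
  mabs (Theta v) *m mabs X = mabs (Theta v *m X).
Proof.
apply/matrixP => i j; rewrite mul_diag_mx !mxE (bigD1 i)//= big1 ?addr0.
  by rewrite !mxE eqxx mulr1n normrM.
by move=> l; rewrite eq_sym !mxE => /negPf ->; rewrite mulr0n normr0 mul0r.
Qed.

Lemma mabs_Theta_ddag k (v u : 'cV[R]_k) :
  mabs (Theta (ddag v)) *m u = quot u (mabs v).
Proof.
apply/colP => i; rewrite !mxE (bigD1 i)//= big1 ?addr0.
  by rewrite !mxE eqxx mulr1n /inv1 normr_eq0; case: eqP; rewrite ?normr1 ?normfV.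
by move=> l; rewrite eq_sym !mxE => /negPf ->; rewrite mulr0n normr0 mul0r.
Qed.

Lemma quot_const k (u : 'cV[R]_k) (c : R) :
  0 < c -> normoo (quot u (mabs (const_mx c))) = normoo u / c.
Proof.
move=> c0; rewrite !normooE (_ : quot _ _ = c^-1 *: u).
  by rewrite normrZ gtr0_norm ?invr_gt0// mulrC.
by apply/colP => i; rewrite !mxE /inv1 gtr0_norm// gt_eqF.
Qed.

End EntrywiseAlgebra.

Theorem theorem5 (R : realType) (n m p s r q k : nat)
    (S1 : {vspace 'M[R]_n}) (S2 : {vspace 'M[R]_m}) (S3 : {vspace 'M[R]_p})
    (Phi1 : 'M[R]_(n * n, s)) (Phi2 : 'M[R]_(m * m, r))
    (Phi3 : 'M[R]_(p * p, q))
    (hPhi1 : structure_matrix S1 Phi1)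
    (hPhi2 : structure_matrix S2 Phi2)
    (hPhi3 : structure_matrix S3 Phi3)
    (A : 'M[R]_n) (B : 'M[R]_(m, n)) (C : 'M[R]_(p, m))
    (D : 'M[R]_m) (E : 'M[R]_p)
    (hA : A \in S1) (hD : D \in S2) (hE : E \in S3)
    (b : 'cV[R]_(n + m + p))
    (x : 'cV[R]_n) (y : 'cV[R]_m) (z : 'cV[R]_p)
    (L : 'M[R]_(k, n + m + p)) (hk : (k <= n + m + p)%N) :
  let H := Blocks A B C D E in
  let w := col_mx (col_mx x y) z in
  let M := L *m invmx (saddle_mx H) *m row_mx (Gmx x y z) (- 1%:M)
             *m block_mx (PhiS Phi1 Phi2 Phi3) 0 0 1%:M in
  saddle_mx H \in unitmx ->
  saddle_mx H *m w = b ->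
  (forall (Psi : blocks R n m p) (chi : 'cV[R]_(n + m + p)) (xi : 'cV[R]_k),
     bA Psi \in S1 -> bD Psi \in S2 -> bE Psi \in S3 ->
     struct_cond S1 S2 S3 Psi chi xi H b L =
       (normoo (mabs (Theta (ddag xi)) *m mabs M
                *m col_mx (vecS_abs Phi1 Phi2 Phi3 Psi) (mabs chi)))%:E)
  /\
  (L *m w <> 0 ->
     struct_cond S1 S2 S3 H b (const_mx (normoo (L *m w))) H b L =
       (normoo (mabs M *m col_mx (vecS_abs Phi1 Phi2 Phi3 H) (mabs b))
        / normoo (L *m w))%:E
     /\
     struct_cond S1 S2 S3 H b (L *m w) H b L =
       (normoo (quot (mabs M *m col_mx (vecS_abs Phi1 Phi2 Phi3 H) (mabs b))
                     (mabs (L *m w))))%:E).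
Proof.
move=> H w M unitH solw.
have main Psi chi (xi : 'cV[R]_k) :
    bA Psi \in S1 -> bD Psi \in S2 -> bE Psi \in S3 ->
    struct_cond S1 S2 S3 Psi chi xi H b L =
      (normoo (mabs (Theta (ddag xi)) *m mabs M
               *m col_mx (vecS_abs Phi1 Phi2 Phi3 Psi) (mabs chi)))%:E.
  move=> PA PD PE.
  rewrite (struct_condE hPhi1 hPhi2 hPhi3 L unitH solw) ?mabs_Theta_mulmx//.
  by rewrite /gen_vec /mabs map_col_mx.
split=> // Lw0.
rewrite !main// -!mulmxA !mabs_Theta_ddag quot_const//.
by rewrite normooE normr_gt0; apply/eqP.
Qed.
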